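(* Let $(\Omega,\mathcal F,\mathbf P)$, $A$, $X$, $\theta$, $\Theta=\mathbb R_{\ge 0}^n$, $G=\mathbb R_{>0}^d$ and the action of $G$ on $\mathbb Z_{\ge 0}^d\times\Theta$ be as described in the context. Then the sub $\sigma$-algebra $$\mathcal O:=\bigl\{\{(AX,\theta)\in B\}\ \big|\ B\in\mathcal B(\mathbb Z_{\ge 0}^d)\times\mathcal B(\Theta),\ G\cdot B=B\bigr\}$$ of $\mathcal F$ is of interest with respect to $(\sigma(X),\sigma(AX,\theta))$; that is, for every $Y\in\mathcal L^1(\sigma(X))$ some version of $\mathbf E(Y\mid \sigma(AX,\theta))$ is $\mathcal O$-measurable.
   Context: Setting. $(\Omega,\mathcal F,\mathbf P)$ is a probability space, $A=(a_{ij})$ is a $d\times n$ integer matrix, $\Theta:=\mathbb R_{\ge 0}^n$ with Borel $\sigma$-algebra $\mathcal B(\Theta)$. The parameter is treated as a random variable: $\theta:\Omega\to\Theta$ is measurable, and $X=(X_1,\dots,X_n)^\top:\Omega\to\mathbb Z_{\ge 0}^n$ is a random vector such that, conditionally on $\theta=c=(c_1,\dots,c_n)^\top$, the $X_k$ are mutually independent with $X_k\sim\mathrm{Pois}(c_k)$ (where $\mathrm{Pois}(0)$ is the point mass at $0$). It is assumed that $AX$ takes values in $\mathbb Z_{\ge 0}^d$ (e.g. $A$ has non-negative entries). Group action. The multiplicative group $G:=\mathbb R_{>0}^d$ acts on $\Theta$ by $g\cdot c=\bigl(c_j\prod_{i=1}^d g_i^{a_{ij}}\bigr)_{j=1,\dots,n}$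 and on $\mathbb Z_{\ge 0}^d\times\Theta$ by $g\cdot(b,c)=(b,g\cdot c)$. For a subset $B$, $G\cdot B:=\{g\cdot x\mid g\in G,\ x\in B\}$. $\mathcal B(\mathbb Z_{\ge 0}^d)\times\mathcal B(\Theta)$ denotes the product $\sigma$-algebra ($\mathbb Z_{\ge0}^d$ is discrete). Notation. For a sub $\sigma$-algebra $\mathcal H$ of $\mathcal F$, $\mathcal L^1(\mathcal H)$ is the space of integrable $\mathcal H$-measurable real random variables. A sub $\sigma$-algebra $\mathcal I$ is said to be of interest with respect to a pair of sub $\sigma$-algebras $(\mathcal D,\mathcal G)$ if for all $Y\in\mathcal L^1(\mathcal D)$ a version of $\mathbf E(Y\mid\mathcal G)$ is $\mathcal I$-measurable. *)

(* Defs.v *)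
From HB Require Import structures.
From mathcomp Require Import all_boot all_order all_algebra.
From mathcomp Require Import all_classical all_reals all_analysis.

Set Implicit Arguments.
Unset Strict Implicit.
Unset Printing Implicit Defensive.

Import Order.TTheory GRing.Theory Num.Theory.
Import numFieldNormedType.Exports.

Local Open Scope classical_set_scope.
Local Open Scope ring_scope.

(* The type T with its Borel sigma-algebra. For T = 'cV[nat]_n the topology is
   the product of discrete ones, hence discrete. *)
Notation borel T := (g_sigma_algebraType (@open T)).

Section conditional_expectation.
Local Open Scope ereal_scope.
Context {disp : measure_display} {Omega : measurableType disp} {R : realType}
  (P : probability Omega R).

Definition is_sub_sigma_algebra (H : set (set Omega)) : Prop :=
  sigma_algebra setT H /\ H `<=` measurable.

Definition L1 (H : set (set Omega)) : set (Omega -> R) :=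
  [set Y | g_sigma_algebra_preimage Y `<=` H /\ P.-integrable setT (EFin \o Y)].

(* Z is a version of E(Y | H). *)
Definition cond_exp_version (H : set (set Omega)) (Y Z : Omega -> R) : Prop :=
  L1 H Z /\
  forall E, H E -> \int[P]_(w in E) (Z w)%:E = \int[P]_(w in E) (Y w)%:E.

Definition of_interest (I D H : set (set Omega)) : Prop :=
  forall Y, L1 D Y ->
    exists2 Z, cond_exp_version H Y Z & g_sigma_algebra_preimage Z `<=` I.

End conditional_expectation.

Section conditional_law.
Local Open Scope ereal_scope.

Definition mutually_independent d (T : measurableType d) (R : realType)
    (mu : {measure set T -> \bar R}) (I : finType) d' (T' : measurableType d')
    (Y : I -> T -> T') : Prop :=
  forall (J : {set I}) (U : I -> set T'), (forall k, measurable (U k)) ->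
    mu [set t | forall k, k \in J -> U k (Y k t)] =
    \prod_(k in J) mu (Y k @^-1` U k).

(* kappa is a regular conditional distribution of X given theta. *)
Definition is_cond_distribution d (Omega : measurableType d) (R : realType)
    (P : probability Omega R) d1 (T1 : measurableType d1)
    d2 (T2 : measurableType d2) (X : Omega -> T1) (theta : Omega -> T2)
    (kappa : R.-pker T2 ~> T1) : Prop :=
  forall E B, measurable E -> measurable B ->
    P ((X @^-1` E) `&` (theta @^-1` B)) =
    \int[P]_(w in theta @^-1` B) kappa (theta w) E.

End conditional_law.

Section parameter_space.
Context {R : realType}.

Definition Theta (n : nat) : set 'cV[R]_n := [set c | forall j, 0 <= c j 0].

(* The second argument of poisson_prob is a dummy, and poisson_prob 0 _ is the
   Dirac mass at 0. *)
Definition conditionally_poisson d (Omega : measurableType d)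
    (P : probability Omega R) (n : nat) (X : Omega -> borel 'cV[nat]_n)
    (theta : Omega -> borel 'cV[R]_n) : Prop :=
  exists kappa : R.-pker borel 'cV[R]_n ~> borel 'cV[nat]_n,
    is_cond_distribution P X theta kappa /\
    forall c, Theta c ->
      mutually_independent (kappa c)
        (fun (k : 'I_n) (x : borel 'cV[nat]_n) => (x : 'cV[nat]_n) k 0) /\
      forall (k : 'I_n) (U : set nat),
        kappa c [set x | U ((x : 'cV[nat]_n) k 0)]
        = poisson_prob (c k 0) 0%N U.

Definition G (d : nat) : set 'cV[R]_d := [set g | forall i, 0 < g i 0].

Definition act_Theta (d n : nat) (A : 'M[int]_(d, n)) (g : 'cV[R]_d)
    (c : 'cV[R]_n) : 'cV[R]_n :=
  \col_j (c j 0 * \prod_i g i 0 ^ A i j).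

Definition act (d n : nat) (A : 'M[int]_(d, n)) (g : 'cV[R]_d)
    (p : borel 'cV[nat]_d * borel 'cV[R]_n) :
    borel 'cV[nat]_d * borel 'cV[R]_n :=
  (p.1, act_Theta A g p.2).

Definition G_saturation (d n : nat) (A : 'M[int]_(d, n))
    (B : set (borel 'cV[nat]_d * borel 'cV[R]_n)) :
    set (borel 'cV[nat]_d * borel 'cV[R]_n) :=
  [set act A g p | g in @G d & p in B].

(* Theta being closed, the product of the Borel sigma-algebras of Z_{>=0}^d and
   Theta consists of the measurable subsets of Z_{>=0}^d x R^n that lie in
   Z_{>=0}^d x Theta. *)
Definition invariant_sigma_algebra (Omega : Type) (d n : nat)
    (A : 'M[int]_(d, n)) (AX : Omega -> borel 'cV[nat]_d)
    (theta : Omega -> borel 'cV[R]_n) : set (set Omega) :=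
  [set (fun w => (AX w, theta w)) @^-1` B | B in
    [set B : set (borel 'cV[nat]_d * borel 'cV[R]_n) |
      [/\ measurable B, B `<=` setT `*` @Theta n &
          G_saturation A B = B]]].

End parameter_space.

(* Main.v *)
(* The version of E(f(X) | AX, theta) is the elementary conditional mean
   (sum_{Ax = b} f(x) c^x / x!) / (sum_{Ax = b} c^x / x!). Since
   (g.c)^x = g^(Ax) c^x, the action of g multiplies both sums by the same
   factor g^b, so the quotient depends only on b and the orbit of c. The
   nonnegative and the negative part of f are treated separately, with values
   in [0, +oo], which avoids all convergence questions; by integrability the
   value +oo is taken with probability zero. *)
Require Import Defs.
From HB Require Import structures.
From mathcomp Require Import all_boot all_order all_algebra.
From mathcomp Require Import all_classical all_reals all_analysis.
From mathcomp Require Import measurable_realfun ring.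

Set Implicit Arguments.
Unset Strict Implicit.
Unset Printing Implicit Defensive.

Import Order.TTheory GRing.Theory Num.Theory.
Import numFieldNormedType.Exports.

Local Open Scope classical_set_scope.
Local Open Scope ring_scope.

(** * Measurability over countable spaces *)

Section countable_measurable.
Context d (T : measurableType d) (T_countable : countable [set: T])
  (T1 : forall x : T, measurable [set x]).

Lemma countable_set_measurable (A : set T) : measurable A.
Proof.
apply: countable_measurable => //.
exact: sub_countable (subset_card_le (@subsetT _ A)) T_countable.
Qed.

(** Slicing along the countable factor writes each preimage as a countable union of measurable
    rectangles. *)
Lemma countable_prod_fun_measurable d2 (T2 : measurableType d2)
    d' (T' : measurableType d') (F : T * T2 -> T') :
  (forall x, measurable_fun setT (fun y => F (x, y))) -> measurable_fun setT F.
Proof.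
move=> mF _ B mB; rewrite setTI.
have -> : F @^-1` B = \bigcup_x ([set x] `*` ((fun y => F (x, y)) @^-1` B)).
  apply/seteqP; split=> [[x y] /= FB|[x y] [x' _ [/= -> ]]//].
  by exists x.
apply: countable_bigcupT_measurable => // x.
apply: measurableX => //.
by rewrite -[X in measurable X]setTI; exact: mF.
Qed.

End countable_measurable.

(** * Borel sets of integer and real vectors *)

Section matrix_borel.

Lemma countable_borel_mx (n : nat) : countable [set: borel 'cV[nat]_n].
Proof. exact: (@countableP 'cV[nat]_n). Qed.

(** Singletons are open: entrywise singletons form a neighbourhood in the product of discrete
    topologies. *)
Lemma borel_mx_set1_measurable (n : nat) (x : borel 'cV[nat]_n) :
  measurable [set x].
Proof.
apply: sub_sigma_algebra => /=.
rewrite openE => _ ->.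
exists (fun i j => [set (x : 'cV[nat]_n) i j]).
  by move=> i j; exact: discrete_set1.
by move=> M /= ME; apply/matrixP => i j; rewrite ME.
Qed.

Lemma borel_mx_measurable (n : nat) (U : set (borel 'cV[nat]_n)) : measurable U.
Proof.
exact: countable_set_measurable (@countable_borel_mx n)
  (@borel_mx_set1_measurable n) U.
Qed.

Lemma borel_mx_measurable_fun (n : nat) d (T : measurableType d)
    (f : borel 'cV[nat]_n -> T) : measurable_fun setT f.
Proof. by move=> _ B _; exact: borel_mx_measurable. Qed.

Lemma borel_mx_prod_measurable_fun (n : nat) d2 (T2 : measurableType d2)
    d (T : measurableType d) (F : borel 'cV[nat]_n * T2 -> T) :
  (forall x, measurable_fun setT (fun y => F (x, y))) -> measurable_fun setT F.
Proof.
apply: countable_prod_fun_measurable; first exact: countable_borel_mx.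
exact: borel_mx_set1_measurable.
Qed.

Lemma Theta_measurable (R : realType) (n : nat) :
  measurable (@Theta R n : set (borel 'cV[R]_n)).
Proof.
rewrite -[X in measurable X]setCK.
apply: (@measurableC _ (borel 'cV[R]_n)).
apply: sub_sigma_algebra => /=.
apply: closed_openC.
have -> : @Theta R n = \bigcap_(j in [set: 'I_n])
    ((fun c : 'cV[R]_n => c j 0) @^-1` [set x | 0 <= x]).
  by apply/seteqP; split=> c cT j; [move=> _; exact: cT|exact: (cT j I)].
apply: closed_bigI => j _; apply: preimage_closed => [c _|].
  exact: coord_continuous.
exact: closed_ge.
Qed.

End matrix_borel.

(** * Kernels and disintegration of the joint law *)

Section kernel_precomp.
Context d0 (T0 : measurableType d0) d2 (T2 : measurableType d2)
  d1 (T1 : measurableType d1) (R : realType)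
  (f : T0 -> T2) (kappa : R.-pker T2 ~> T1).

(** A named constant carrying the measurability of [f], so that the probability kernel structure
    declared below can be inferred from it. *)
Definition kernel_precomp (mf : measurable_fun setT f) :
  T0 -> {measure set T1 -> \bar R} := kappa \o f.

Hypothesis mf : measurable_fun setT f.

Let kernel_precomp_measurable (U : set T1) : measurable U ->
  measurable_fun setT (kernel_precomp mf ^~ U).
Proof.
by move=> mU; exact: measurableT_comp (measurable_kernel kappa U mU) mf.
Qed.

HB.instance Definition _ := isKernel.Build _ _ _ _ _ (kernel_precomp mf)
  kernel_precomp_measurable.

Let kernel_precomp_prob x : kernel_precomp mf x [set: T1] = 1%E.
Proof. exact: prob_kernel. Qed.

HB.instance Definition _ := Kernel_isProbability.Build _ _ _ _ _
  (kernel_precomp mf) kernel_precomp_prob.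

End kernel_precomp.

Section disintegration.
Local Open Scope ereal_scope.
Context d (Omega : measurableType d) (R : realType) (P : probability Omega R)
  d1 (T1 : measurableType d1) d2 (T2 : measurableType d2)
  (X : Omega -> T1) (theta : Omega -> T2) (kappa : R.-pker T2 ~> T1).
Hypotheses (mX : measurable_fun setT X) (mtheta : measurable_fun setT theta).

Let mtheta_snd : measurable_fun setT (theta \o @snd unit Omega).
Proof. exact: measurableT_comp. Qed.

Let mgraph : measurable_fun setT
  (fun p : unit * Omega * T1 => (p.2, theta p.1.2)).
Proof.
apply: measurable_fun_pair => //.
by apply: (measurableT_comp mtheta); exact: measurableT_comp.
Qed.

(** A two-stage experiment: draw [w] from [P], then [x] from [kappa (theta w)], and keep
    [(x, theta w)]. The one-point source [unit] turns [P] into a kernel. *)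
Let law : unit -> {measure set (T1 * T2) -> \bar R} :=
  mkcomp (kprobability (measurable_cst (P : pprobability Omega R)))
    (mkcomp (kernel_precomp kappa mtheta_snd) (kdirac mgraph)).

Let integral_law (F : T1 * T2 -> \bar R) : (forall p, 0 <= F p) ->
  measurable_fun setT F ->
  \int[law tt]_p F p = \int[P]_w \int[kappa (theta w)]_x F (x, theta w).
Proof.
move=> F0 mF; rewrite /law integral_kcomp//.
apply: eq_integral => w _; rewrite integral_kcomp//.
by apply: eq_integral => x _; rewrite integral_dirac// diracT mul1e.
Qed.

(** Both sides are integrals of [F], against the image of [P] under [(X, theta)] and against
    [law tt]. The hypothesis on [kappa] says that these finite measures agree on rectangles, a
    pi-system generating the product sigma-algebra, so they are equal. *)
Lemma disintegration (F : T1 * T2 -> \bar R) :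
  is_cond_distribution P X theta kappa ->
  (forall p, 0 <= F p) -> measurable_fun setT F ->
  \int[P]_w F (X w, theta w) =
  \int[P]_w \int[kappa (theta w)]_x F (x, theta w).
Proof.
move=> PE F0 mF; rewrite -integral_law//.
have mXt : measurable_fun setT (fun w => (X w, theta w)).
  exact: measurable_fun_pair.
rewrite -[LHS](@ge0_integral_pushforward _ _ _ _ _ _ mXt P setT)//.
pose C : set (set (T1 * T2)) :=
  [set A `*` B | A in measurable & B in measurable].
apply: eq_measure_integral => A mA _.
apply: (measure_unique C (fun=> setT)) => //.
- by rewrite measurable_prod_measurableType.
- move=> _ _ [A1 mA1 [B1 mB1 <-]] [A2 mA2 [B2 mB2 <-]].
  by rewrite -setXI; exists (A1 `&` A2); [exact: measurableI|
    exists (B1 `&` B2); [exact: measurableI|]].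
- by move=> _; exists setT => //; exists setT => //; rewrite setXTT.
- by apply/seteqP; split=> // x _; exists 0%N.
- move=> _ [E mE [B mB <-]].
  have mEB : measurable (E `*` B) by exact: measurableX.
  transitivity (P ((X @^-1` E) `&` (theta @^-1` B))) => //.
  (* The mass of the rectangle under [law tt] becomes the integral of an indicator; the factor for
     [B] is constant in [x] and leaves the inner integral. *)
  rewrite PE// -[X in _ = law tt X]setIT -integral_indic// integral_law;
    last 2 first.
  - by move=> p; rewrite lee_fin.
  - by apply/measurable_EFinP; exact: measurable_indic.
  rewrite integral_mkcond epatch_indic; apply: eq_integral => w _ /=.
  rewrite muleC -[E]setIT -integral_indic// -ge0_integralZl_EFin//; last first.
    by apply/measurable_EFinP; exact: measurable_indic.
  apply: eq_integral => x _.
  have -> : \1_(theta @^-1` B) w = \1_B (theta w) :> R by [].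
  by rewrite -EFinM setIT !indicE in_setX -mulnb natrM mulrC.
- move=> _; apply: (@le_lt_trans _ _ 1); last exact: ltry.
  exact: (probability_le1 P (A := setT)).
Qed.

End disintegration.

(** * Averages over the fibers of a map *)

Section fiber_mean.
Local Open Scope ereal_scope.
Context d (T : measurableType d) (R : realType) (T' : Type) (a : T -> T').

(* Division by zero makes this [0] when [mu] does not charge the fiber. *)
Definition fiber_mean (mu : set T -> \bar R) (f : T -> \bar R) (z : T') :
    \bar R :=
  \int[mu]_(x in a @^-1` [set z]) f x * ((fine (mu (a @^-1` [set z])))^-1)%:E.

Lemma fiber_mean_ge0 (mu : {measure set T -> \bar R}) (f : T -> \bar R) z :
  (forall x, 0 <= f x) -> 0 <= fiber_mean mu f z.
Proof.
by move=> f0; rewrite mule_ge0 ?integral_ge0// lee_fin invr_ge0 fine_ge0.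
Qed.

Lemma fiber_mean_measurable d2 (T2 : measurableType d2) (kappa : R.-ker T2 ~> T)
    (f : T -> \bar R) z : measurable (a @^-1` [set z]) ->
  measurable_fun setT f -> (forall x, 0 <= f x) ->
  measurable_fun setT (fun c => fiber_mean (kappa c) f z).
Proof.
move=> mF mf f0; rewrite /fiber_mean; set F := a @^-1` _ in mF *.
have mV : measurable_fun setT (fun c => ((fine (kappa c F))^-1)%R).
  (* On nonnegative reals inversion is the power with exponent -1, even at 0, where both give 0;
     powers are measurable. *)
  under eq_fun do rewrite -powR_inv1 ?fine_ge0//.
  apply: (measurableT_comp (measurable_powR _)).
  apply: measurableT_comp; last exact: measurable_kernel.
  exact: fine_measurable.
apply: emeasurable_funM; last exact/measurable_EFinP.
under eq_fun do rewrite integral_mkcond.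
apply: measurable_fun_integral_kernel => [U mU|x|].
- exact: measurable_kernel.
- exact: erestrict_ge0.
- by apply/(measurable_restrictT _ mF); exact: measurable_funTS.
Qed.

Hypothesis T'_countable : countable [set: T'].
Hypothesis a_measurable : forall S, measurable (a @^-1` S).

(** The fibers of [a] form a countable partition, over which integrals of nonnegative functions add
    up. An injection of [T'] into the naturals indexes it, with empty pieces at indices outside the
    range. *)
Lemma eq_integral_fiber (mu : {measure set T -> \bar R}) (f g : T -> \bar R) :
  measurable_fun setT f -> measurable_fun setT g ->
  (forall x, 0 <= f x) -> (forall x, 0 <= g x) ->
  (forall z, \int[mu]_(x in a @^-1` [set z]) f x =
             \int[mu]_(x in a @^-1` [set z]) g x) ->
  \int[mu]_x f x = \int[mu]_x g x.
Proof.
move=> mf mg f0 g0 fg; have /countable_injP[j jinj] := T'_countable.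
have cover : [set: T] = \bigcup_i (a @^-1` (j @^-1` [set i])).
  by apply/seteqP; split=> // x _; exists (j (a x)).
have tI : trivIset setT (fun i => a @^-1` (j @^-1` [set i])).
  apply/trivIsetP => i k _ _ /eqP ik; rewrite -!preimage_setI.
  by apply/seteqP; split=> // x [/= -> /ik].
rewrite cover !ge0_integral_bigcup//; [|exact: measurable_funTS..].
apply: eq_eseriesr => i _.
have [[z jz]|Ni] := pselect (exists z, j z = i).
  have -> : j @^-1` [set i] = [set z]; last exact: fg.
  apply/seteqP; split=> [y /= jy|_ ->//].
  by apply: jinj; rewrite ?inE// jy.
have -> : a @^-1` (j @^-1` [set i]) = set0; last by rewrite !integral_set0.
by apply/seteqP; split=> // x /= axi; apply: Ni; exists (a x).
Qed.

(** On one fiber [H] and the mean are constant, so integrating the mean multiplies it by the mass of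
    the fiber, which cancels the denominator. *)
Lemma integral_fiber_mean (mu : {measure set T -> \bar R})
    (f : T -> \bar R) (H : T' -> \bar R) :
  fin_num_fun mu -> measurable_fun setT f ->
  (forall x, 0 <= f x) -> (forall z, 0 <= H z) ->
  \int[mu]_x (H (a x) * fiber_mean mu f (a x)) = \int[mu]_x (H (a x) * f x).
Proof.
move=> mufin mf f0 H0.
have ma (h : T' -> \bar R) : measurable_fun setT (h \o a).
  by move=> _ B _; rewrite setTI comp_preimage; exact: a_measurable.
apply: eq_integral_fiber => [||x|x|z].
- exact: (ma (fun z => H z * fiber_mean mu f z)).
- by apply: emeasurable_funM => //; exact: ma.
- by rewrite mule_ge0// fiber_mean_ge0.
- by rewrite mule_ge0.
pose F := a @^-1` [set z]; have mF : measurable F by exact: a_measurable.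
have mfF : measurable_fun F f by exact: measurable_funTS.
transitivity (\int[mu]_(x in F) (H z * fiber_mean mu f z)).
  by apply: eq_integral => x; rewrite inE => ->.
transitivity (\int[mu]_(x in F) (H z * f x)); last first.
  by apply: eq_integral => x; rewrite inE => ->.
rewrite integral_cst// [RHS]ge0_integralZl// -muleA; congr (_ * _).
rewrite /fiber_mean -/F -muleA.
(* On a fiber of mass 0 nothing cancels, but the integral of [f] over it vanishes as well. *)
have [muF0|muF0] := eqVneq (mu F) 0.
  by rewrite null_set_integral// mul0e.
have Ffin : mu F \is a fin_num by exact: mufin.
by rewrite -[X in _ * (_ * X)](fineK Ffin) -EFinM mulVf ?mule1// fine_eq0.
Qed.

End fiber_mean.

(** * Point masses and products of Poisson laws *)

Section countable_measure.
Local Open Scope ereal_scope.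
Context d (T : measurableType d) (R : realType)
  (T_countable : countable [set: T]) (T1 : forall x : T, measurable [set x]).

(** By countable additivity over points. Comparing only the points of [U] allows an application to
    measures that match on a single fiber. *)
Lemma eq_measure_countable (m1 m2 : {measure set T -> \bar R}) (U : set T) :
  (forall x, U x -> m1 [set x] = m2 [set x]) -> m1 U = m2 U.
Proof.
move=> m12; have /countable_injP[j jinj] := T_countable.
have -> : U = \bigcup_i (U `&` j @^-1` [set i]).
  rewrite -setI_bigcupr; apply/seteqP; split=> [x Ux|x []//].
  by split=> //; exists (j x).
have mU (V : set T) : measurable V by exact: countable_set_measurable.
have tI : trivIset setT (fun i => U `&` j @^-1` [set i]).
  apply/trivIsetP => i k _ _ /eqP ik.
  by apply/seteqP; split=> // x [[_ /= ->] [_ /ik]].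
rewrite !measure_bigcup//; apply: eq_eseriesr => i _.
have [[x [Ux jx]]|Ni] := pselect (exists x, U x /\ j x = i).
  suff -> : U `&` j @^-1` [set i] = [set x] by exact: m12.
  apply/seteqP; split=> [y [_ /= jy]|_ -> //]; apply: jinj; rewrite ?inE// jy.
  exact: esym.
suff -> : U `&` j @^-1` [set i] = set0 by rewrite !measure0.
by apply/seteqP; split=> // x [Ux jx]; apply: Ni; exists x.
Qed.

End countable_measure.

Lemma poisson_prob_set1 (R : realType) (r : R) (k m : nat) : 0 <= r ->
  poisson_prob r m [set k] = (r ^+ k / k`!%:R * expR (- r))%:E.
Proof.
rewrite le_eqVlt /poisson_prob => /predU1P[<-|r0].
  (* At rate 0 the law is the Dirac mass at 0, and the formula gives the same because
     [0 ^+ 0 = 1]. *)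
  rewrite ltxx diracE oppr0 expR0 mulr1 expr0n.
  case: k => [|k]; first by rewrite mem_set// fact0 divr1.
  by rewrite memNset ?mul0r.
by rewrite r0 esum_set1 ?lee_fin ?poisson_pmf_ge0// /poisson_pmf r0.
Qed.

Section poisson_vector.
Context (R : realType) (n : nat).
Implicit Types (c : 'cV[R]_n).

(** The product of the laws Pois(c_k), encoded by its point masses, which determine a measure on a
    countable space. *)
Definition is_poisson_vector c
    (mu : {measure set (borel 'cV[nat]_n) -> \bar R}) :=
  forall x : borel 'cV[nat]_n, mu [set x] =
    (\prod_k (c k 0 ^+ (x : 'cV[nat]_n) k 0 / ((x : 'cV[nat]_n) k 0)`!%:R
              * expR (- c k 0)))%:E.

(** Independence is applied to all coordinates at once with singleton events, whose intersection is
    the point [x]. *)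
Lemma independent_is_poisson_vector c
    (mu : {measure set (borel 'cV[nat]_n) -> \bar R}) : Theta c ->
  mutually_independent mu
    (fun (k : 'I_n) (x : borel 'cV[nat]_n) => (x : 'cV[nat]_n) k 0) ->
  (forall (k : 'I_n) (U : set nat),
    mu [set x | U ((x : 'cV[nat]_n) k 0)] = poisson_prob (c k 0) 0%N U) ->
  is_poisson_vector c mu.
Proof.
move=> c0 ind marg x.
have := ind (finset.setTfor 'I_n)
  (fun k => [set (x : 'cV[nat]_n) k 0]) (fun=> Logic.I).
have -> : [set t : borel 'cV[nat]_n | forall k, k \in finset.setTfor 'I_n ->
    [set (x : 'cV[nat]_n) k 0] ((t : 'cV[nat]_n) k 0)] = [set x].
  apply/seteqP; split=> [t /= tx|t -> //].
  by apply/matrixP => k j; rewrite ord1; apply: tx; rewrite finset.in_setT.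
move=> ->; rewrite -prodEFin; apply: eq_big => [k|k _].
  by rewrite finset.in_setT.
by rewrite -(poisson_prob_set1 _ 0%N)// -marg.
Qed.

End poisson_vector.

(** * Poisson densities along an orbit *)

Section orbit.
Context (R : realType) (d n : nat) (A : 'M[int]_(d, n)).
Implicit Types (g : 'cV[R]_d) (c : 'cV[R]_n).

(** Exchanging the two products gathers, for each [g i 0], the exponents [A i k * x k 0] into one
    entry of Ax. Exponents may be negative, so adding them uses that [g i 0] is nonzero. *)
Lemma act_Theta_monomial g c (x : 'cV[nat]_n) : G g ->
  \prod_k act_Theta A g c k 0 ^+ x k 0 =
  \prod_i g i 0 ^ (A *m map_mx Posz x) i 0 * \prod_k c k 0 ^+ x k 0.
Proof.
move=> g0; under eq_bigr do rewrite mxE exprMn.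
rewrite big_split mulrC /=; congr (_ * _).
under eq_bigr do rewrite -prodrXl.
rewrite exchange_big; apply: eq_bigr => i _ /=.
have gi0 : g i 0 != 0 by rewrite gt_eqF.
rewrite mxE (big_morph _ (fun m n => expfzDr m n gi0) (expr0z _)).
by apply: eq_bigr => k _; rewrite exprnP exprz_exp mxE.
Qed.

Lemma act_Theta_Theta g c : G g -> Theta c -> Theta (act_Theta A g c).
Proof.
move=> g0 c0 j; rewrite mxE mulr_ge0// prodr_ge0// => i _.
by rewrite exprz_ge0// ltW.
Qed.

(* The density at [g . c] over the density at [c] on the fiber [A x = z]. *)
Definition orbit_ratio g c (z : 'cV[int]_d) : R :=
  \prod_i g i 0 ^ z i 0 * \prod_k expR (c k 0 - act_Theta A g c k 0).

Lemma orbit_ratio_gt0 g c z : G g -> 0 < orbit_ratio g c z.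
Proof.
move=> g0; rewrite mulr_gt0 ?prodr_gt0// => [i _|k _]; last exact: expR_gt0.
exact: exprz_gt0.
Qed.

Lemma poisson_vector_act g c
    (mu mug : {measure set (borel 'cV[nat]_n) -> \bar R})
    (x : borel 'cV[nat]_n) : G g ->
  is_poisson_vector c mu -> is_poisson_vector (act_Theta A g c) mug ->
  mug [set x] =
  ((orbit_ratio g c (A *m map_mx Posz (x : 'cV[nat]_n)))%:E * mu [set x])%E.
Proof.
move=> g0 mu1 mug1; rewrite mu1 mug1 -EFinM; congr EFin.
rewrite !big_split /= act_Theta_monomial// /orbit_ratio.
under [X in _ = _ * X * _]eq_bigr do rewrite expRD.
rewrite big_split /=.
(* The factors exp(c_k) in the ratio cancel the factors exp(-c_k) in the mass at [c]. *)
have eK : \prod_k expR (c k 0) * \prod_k expR (- c k 0) = 1.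
  by rewrite -big_split big1//= => k _; rewrite expRxMexpNx_1.
by rewrite -[LHS]mulr1 -[X in _ * X = _]eK; ring.
Qed.

End orbit.

(** * Invariance of fiber averages under the group *)

Section fiber_mean_invariance.
Local Open Scope ereal_scope.
Context (R : realType) (d n : nat) (A : 'M[int]_(d, n)).

Let a (x : borel 'cV[nat]_n) : 'cV[int]_d := A *m map_mx Posz (x : 'cV[nat]_n).

(** On the fiber over [z] the orbit ratio is a positive constant, so [mug] is a multiple of [mu]
    there and the constant cancels in the quotient, also when the fiber has mass 0. *)
Lemma fiber_mean_act (g : 'cV[R]_d) (c : 'cV[R]_n)
    (mu mug : {measure set (borel 'cV[nat]_n) -> \bar R}) f z :
  fin_num_fun mu -> G g ->
  is_poisson_vector c mu -> is_poisson_vector (act_Theta A g c) mug ->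
  (forall x, 0 <= f x) ->
  fiber_mean a mug f z = fiber_mean a mu f z.
Proof.
move=> mufin g0 mu1 mug1 f0; have s0 := orbit_ratio_gt0 A c z g0.
set s := orbit_ratio A g c z in s0; pose s' := NngNum (ltW s0).
have m (U : set (borel 'cV[nat]_n)) : measurable U.
  exact: borel_mx_measurable.
have mugE U : U `<=` a @^-1` [set z] -> mug U = s%:E * mu U.
  move=> Uz; rewrite (eq_measure_countable (@countable_borel_mx n)
    (@borel_mx_set1_measurable n) (m2 := mscale s' mu))//.
  move=> x /Uz axz.
  by rewrite (poisson_vector_act x g0 mu1 mug1) -/(a x) axz.
clearbody s.
rewrite /fiber_mean mugE// (eq_measure_integral (mscale s' mu)); last first.
  by move=> U _; exact: mugE.
rewrite ge0_integral_mscale//.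
by rewrite fineM ?mufin// invfM EFinM muleACA -EFinM mulfV ?gt_eqF// mul1e.
Qed.

End fiber_mean_invariance.

(** * The sigma-algebra of invariant events *)

Section invariant_sets.
Context (R : realType) (d n : nat) (A : 'M[int]_(d, n)).
Implicit Types (B : set (borel 'cV[nat]_d * borel 'cV[R]_n)).

Lemma act_Theta1 (c : 'cV[R]_n) : act_Theta A (const_mx 1) c = c.
Proof.
apply/colP => j; rewrite mxE big1 ?mulr1// => i _.
by rewrite mxE exp1rz.
Qed.

Lemma act_ThetaK (g : 'cV[R]_d) : G g ->
  cancel (act_Theta A g) (act_Theta A (map_mx GRing.inv g)).
Proof.
move=> g0 c; apply/colP => j; rewrite !mxE -mulrA -big_split big1 ?mulr1//=.
move=> i _; have gi0 : g i 0 != 0 by rewrite gt_eqF.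
by rewrite mxE -exprzMl ?unitfE ?invr_eq0// mulfV// exp1rz.
Qed.

Lemma G_inv (g : 'cV[R]_d) : G g -> G (map_mx GRing.inv g).
Proof. by move=> g0 i; rewrite mxE invr_gt0. Qed.

(** The identity of the group acts trivially, so [B] always lies in its saturation; only the
    converse inclusion has content. *)
Lemma G_saturation_idP B : G_saturation A B = B <->
  forall g p, G g -> B p -> B (act A g p).
Proof.
split=> [BE g p g0 Bp|Binv]; first by rewrite -BE; exists g => //; exists p.
apply/seteqP; split=> [_ [g g0 [p Bp <-]]|[b c] Bp]; first exact: Binv.
exists (const_mx 1); first by move=> i; rewrite mxE.
by exists (b, c) => //; rewrite /act act_Theta1.
Qed.

Lemma invariant_sub_sigma_algebra disp (Omega : measurableType disp)
    (AX : Omega -> borel 'cV[nat]_d) (theta : Omega -> borel 'cV[R]_n) :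
  measurable_fun setT AX -> measurable_fun setT theta ->
  (forall w, Theta (theta w)) ->
  is_sub_sigma_algebra (invariant_sigma_algebra A AX theta).
Proof.
move=> mAX mtheta theta0.
have mAXt : measurable_fun setT (fun w => (AX w, theta w)).
  exact: measurable_fun_pair.
have mT : measurable
    (setT `*` @Theta R n : set (borel 'cV[nat]_d * borel 'cV[R]_n)).
  by apply: measurableX => //; exact: Theta_measurable.
split; last first.
  by move=> _ [B [mB _ _] <-]; rewrite -[X in measurable X]setTI; exact: mAXt.
split.
- exists set0; last exact: preimage_set0.
  by split=> //; apply/G_saturation_idP.
- move=> _ [B [mB BT /G_saturation_idP Binv] <-].
  (* The complement is taken inside the parameter space, as the definition demands; [theta] never
     leaves [Theta], so the preimage is still the full complement. *)
  exists ((setT `*` @Theta R n) `\` B); last first.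
    by apply/seteqP; split=> w /= [].
  split; [exact: measurableD|by move=> p []|].
  apply/G_saturation_idP => g [b c] g0 [[_ /= c0] NB].
  split; first by split => //; exact: act_Theta_Theta.
  (* If [g] moved a point from outside [B] into [B], the inverse of [g] would bring it back within
     [B]. *)
  move=> /(Binv _ _ (G_inv g0)).
  by rewrite /act /= act_ThetaK.
- move=> F FE.
  have /choice[B BF] : forall i,
      exists B : set (borel 'cV[nat]_d * borel 'cV[R]_n),
      [/\ measurable B, B `<=` setT `*` @Theta R n & G_saturation A B = B] /\
      (fun w => (AX w, theta w)) @^-1` B = F i.
    by move=> i; have [B ? ?] := FE i; exists B.
  exists (\bigcup_i B i); last first.
    by rewrite preimage_bigcup; apply: eq_bigcupr => i _; have [_] := BF i.
  split.
  + by apply: bigcupT_measurable => i; have [[]] := BF i.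
  + by move=> p [i _]; have [[_ BT _] _] := BF i; exact: BT.
  + apply/G_saturation_idP => g p g0 [i _ Bp]; exists i => //.
    by have [[_ _ /G_saturation_idP Binv] _] := BF i; exact: Binv.
Qed.

End invariant_sets.

(* Points being measurable, [Y] is constant on the fibers of [X]. *)
Lemma factor_through (R : realType) disp (Omega : measurableType disp) d1
    (T1 : measurableType d1) (X : Omega -> T1) (Y : Omega -> R) :
  g_sigma_algebra_preimage Y `<=` g_sigma_algebra_preimage X ->
  exists f : T1 -> R, Y = f \o X.
Proof.
move=> YX.
have /choice[f fE] : forall x, exists r, forall w, X w = x -> Y w = r.
  move=> x; have [[w0 Xw0]|NX] := pselect (exists w, X w = x); last first.
    by exists 0 => w Xw; exfalso; apply: NX; exists w.
  exists (Y w0) => w Xw.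
  have /YX[B _] : g_sigma_algebra_preimage Y (Y @^-1` [set Y w0]).
    by exists [set Y w0]; rewrite ?setTI.
  rewrite setTI => XB.
  have : (Y @^-1` [set Y w0]) w0 by [].
  by rewrite -XB /= Xw0 -Xw -[B _]/((X @^-1` B) w) XB.
by exists f; apply/funext => w /=; exact: fE.
Qed.

(** * The posterior mean as a conditional expectation *)

Section conditional_expectation.
Local Open Scope ereal_scope.
Context (R : realType) disp (Omega : measurableType disp)
  (P : probability Omega R) (d n : nat) (A : 'M[int]_(d, n))
  (X : Omega -> borel 'cV[nat]_n) (theta : Omega -> borel 'cV[R]_n)
  (AX : Omega -> borel 'cV[nat]_d)
  (kappa : R.-pker borel 'cV[R]_n ~> borel 'cV[nat]_n).
Hypotheses (mX : measurable_fun setT X) (mtheta : measurable_fun setT theta)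
  (theta_Theta : forall w, Theta (theta w))
  (kappa_cond : is_cond_distribution P X theta kappa)
  (kappa_poisson : forall c, Theta c -> is_poisson_vector c (kappa c))
  (AXE : forall w, map_mx Posz (AX w) = A *m map_mx Posz (X w)).

Let a (x : borel 'cV[nat]_n) : 'cV[int]_d := A *m map_mx Posz (x : 'cV[nat]_n).

(** [AX] is a function of [X], its natural entries being recovered by [absz], and every function on
    the countable space of values of [X] is measurable. *)
Lemma AX_measurable : measurable_fun setT AX.
Proof.
rewrite (_ : AX = (fun x => map_mx absz (a x) : borel 'cV[nat]_d) \o X).
  by apply: measurableT_comp => //; exact: borel_mx_measurable_fun.
by apply/funext => w; apply/colP => i; rewrite /= /a -AXE !mxE.
Qed.

(* [E(f(X) | AX = b, theta = c)] for [p = (b, c)] *)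
Definition posterior_mean (f : borel 'cV[nat]_n -> R)
    (p : borel 'cV[nat]_d * borel 'cV[R]_n) :=
  fiber_mean a (kappa p.2) (EFin \o f) (map_mx Posz (p.1 : 'cV[nat]_d)).

Let fiber_mean_measurable_f (f : borel 'cV[nat]_n -> R) (z : 'cV[int]_d) :
  (forall x, (0 <= f x)%R) ->
  measurable_fun setT (fun c => fiber_mean a (kappa c) (EFin \o f) z).
Proof.
move=> f0; have f0' x : 0 <= (EFin \o f) x by rewrite lee_fin.
exact: (@fiber_mean_measurable _ _ R _ a _ _ kappa _ _
  (borel_mx_measurable _) (borel_mx_measurable_fun _) f0').
Qed.

Lemma posterior_mean_measurable f : (forall x, (0 <= f x)%R) ->
  measurable_fun setT (posterior_mean f).
Proof.
move=> f0; apply: borel_mx_prod_measurable_fun => b.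
exact: (fiber_mean_measurable_f (map_mx Posz (b : 'cV[nat]_d)) f0).
Qed.

Lemma posterior_mean_act f g p : (forall x, (0 <= f x)%R) -> G g -> Theta p.2 ->
  posterior_mean f (act A g p) = posterior_mean f p.
Proof.
move=> f0 g0 p0; apply: (@fiber_mean_act _ _ _ A g p.2) => //.
- exact: kernel_finite_transition.
- exact: kappa_poisson.
- by apply: kappa_poisson; exact: act_Theta_Theta.
Qed.

(** Disintegration reduces the claim to a fixed value of [theta]. There the indicator of [B] depends
    on [x] only through Ax, so it serves as the weight [H] in the averaging identity on fibers. *)
Lemma integral_posterior_mean f B : (forall x, (0 <= f x)%R) -> measurable B ->
  \int[P]_(w in (fun w => (AX w, theta w)) @^-1` B)
    posterior_mean f (AX w, theta w) =
  \int[P]_(w in (fun w => (AX w, theta w)) @^-1` B) (f (X w))%:E.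
Proof.
move=> f0 mB.
(* [r] extends the indicator of [B] to all integer vectors [z]; only its values at [a (X w)], where
   it returns [AX w], enter the integrals over [P]. *)
pose r (z : 'cV[int]_d) : borel 'cV[nat]_d := map_mx absz z.
pose H c z : \bar R := (\1_B (r z, c))%:E.
have rK w : r (a (X w)) = AX w.
  by rewrite /r /a -AXE; apply/colP => i; rewrite !mxE.
have mH x : measurable_fun setT (fun c => H c (a x)).
  apply/measurable_EFinP.
  apply: measurableT_comp; first exact: measurable_indic.
  exact: measurable_fun_pair.
have H0 c z : 0 <= H c z by rewrite lee_fin.
pose q c z := fiber_mean a (kappa c) (EFin \o f) z.
have q0 c z : 0 <= q c z by apply: fiber_mean_ge0 => x; rewrite lee_fin.
transitivity (\int[P]_w (H (theta w) (a (X w)) * q (theta w) (a (X w)))).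
  rewrite integral_mkcond epatch_indic; apply: eq_integral => w _ /=.
  by rewrite muleC /H rK /posterior_mean /= AXE.
transitivity (\int[P]_w (H (theta w) (a (X w)) * (f (X w))%:E)); last first.
  rewrite [RHS]integral_mkcond epatch_indic; apply: eq_integral => w _ /=.
  by rewrite muleC /H rK.
have mq x : measurable_fun setT (fun c => q c (a x)).
  exact: (fiber_mean_measurable_f (a x) f0).
rewrite (disintegration mX mtheta
  (F := fun p => H p.2 (a p.1) * q p.2 (a p.1)) kappa_cond); last 2 first.
- by move=> p; exact: mule_ge0.
- apply: borel_mx_prod_measurable_fun => x.
  exact: (emeasurable_funM (mH x) (mq x)).
rewrite (disintegration mX mtheta
  (F := fun p => H p.2 (a p.1) * (f p.1)%:E) kappa_cond); last 2 first.
- by move=> p; rewrite mule_ge0// lee_fin.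
- apply: borel_mx_prod_measurable_fun => x.
  exact: (emeasurable_funM (mH x) (measurable_cst (f x)%:E)).
apply: eq_integral => w _ /=.
have f0' x : 0 <= (EFin \o f) x by rewrite lee_fin.
exact: (@integral_fiber_mean _ _ R _ a (@countableP 'cV[int]_d _)
  (fun S => borel_mx_measurable (a @^-1` S)) (kappa (theta w))
  (EFin \o f) (H (theta w))
  (@kernel_finite_transition _ _ _ _ _ kappa (theta w))
  (borel_mx_measurable_fun _) f0' (H0 _)).
Qed.

(** Integrability of f(X) makes the posterior mean integrable, hence almost surely finite, so [fine]
    alters it only on a null set. *)
Lemma integral_fine_posterior_mean f : (forall x, (0 <= f x)%R) ->
  P.-integrable setT (EFin \o (f \o X)) ->
  P.-integrable setT (fun w => (fine (posterior_mean f (AX w, theta w)))%:E) /\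
  forall B, measurable B ->
  \int[P]_(w in (fun w => (AX w, theta w)) @^-1` B)
    (fine (posterior_mean f (AX w, theta w)))%:E =
  \int[P]_(w in (fun w => (AX w, theta w)) @^-1` B) (f (X w))%:E.
Proof.
move=> f0 /integrableP[_ fX_fin].
set b := fun w => posterior_mean f (AX w, theta w).
have mAXt : measurable_fun setT (fun w => (AX w, theta w)).
  by apply: measurable_fun_pair => //; exact: AX_measurable.
have mb : measurable_fun setT b.
  exact: (measurableT_comp (posterior_mean_measurable f0) mAXt).
have b0 w : 0 <= b w by apply: fiber_mean_ge0 => x; rewrite lee_fin.
have mfb : measurable_fun setT (EFin \o (fine \o b)).
  apply/measurable_EFinP; apply: (measurableT_comp _ mb).
  exact: fine_measurable.
have b_int : P.-integrable setT b.
  apply/integrableP; split=> //.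
  have <- : \int[P]_w b w = \int[P]_w `|b w|.
    by apply: eq_integral => w _; rewrite gee0_abs.
  (* With [B] the whole space, the total integral of the mean is that of f(X). *)
  have := integral_posterior_mean f0
    (measurableT : measurable [set: borel 'cV[nat]_d * borel 'cV[R]_n]).
  rewrite preimage_setT => ->.
  rewrite (eq_integral (abse \o (EFin \o (f \o X))))//.
  by move=> w _ /=; rewrite ger0_norm.
split.
  apply: (le_integrable measurableT mfb _ b_int) => w _ /=.
  (* [fine] sends +oo to 0, so it never increases the absolute value. *)
  by case: (b w) (b0 w) => //= _; rewrite normr0 leey.
move=> B mB; rewrite -integral_posterior_mean//.
have mE : measurable ((fun w => (AX w, theta w)) @^-1` B).
  by rewrite -[X in measurable X]setTI; exact: mAXt.
apply: ae_eq_integral => //; [exact: measurable_funTS|exact: measurable_funTS|].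
apply: filterS (integrable_ae measurableT b_int) => w /= bfin _.
by rewrite fineK// bfin.
Qed.

End conditional_expectation.

(** * An invariant version of the conditional expectation *)

Theorem theorem3 (R : realType) (disp : measure_display)
    (Omega : measurableType disp) (P : probability Omega R)
    (d n : nat) (A : 'M[int]_(d, n))
    (X : Omega -> borel 'cV[nat]_n) (theta : Omega -> borel 'cV[R]_n)
    (AX : Omega -> borel 'cV[nat]_d)
    (mX : measurable_fun setT X)
    (mtheta : measurable_fun setT theta)
    (theta_Theta : forall w, Theta (theta w))
    (X_poisson : conditionally_poisson P X theta)
    (AXE : forall w, map_mx Posz (AX w) = A *m map_mx Posz (X w)) :
  let calO := invariant_sigma_algebra A AX theta in
  is_sub_sigma_algebra calO /\
  of_interest P calO (g_sigma_algebra_preimage X)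
    (g_sigma_algebra_preimage (fun w => (AX w, theta w))).
Proof.
move=> calO; have mAX := AX_measurable mX AXE.
split; first exact: invariant_sub_sigma_algebra.
have [kappa [kappa_cond kappa_indep]] := X_poisson.
have kappa_poisson c : Theta c -> is_poisson_vector c (kappa c).
  move=> c0; have [? ?] := kappa_indep c c0.
  exact: independent_is_poisson_vector.
move=> Y [/factor_through[f ->] Yint].
have fp0 x : 0 <= (f^\+)%R x := funrpos_ge0 f x.
have fn0 x : 0 <= (f^\-)%R x := funrneg_ge0 f x.
have [pint pE] := integral_fine_posterior_mean mX mtheta kappa_cond AXE fp0
  (integrable_funrpos measurableT Yint).
have [nint nE] := integral_fine_posterior_mean mX mtheta kappa_cond AXE fn0
  (integrable_funrneg measurableT Yint).
(* Both means are made real before subtracting, so no difference of infinities arises. As a function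
   of the pair, [h] has level sets that can be tested for invariance. *)
pose h p := fine (posterior_mean A kappa (f^\+)%R p)
  - fine (posterior_mean A kappa (f^\-)%R p).
pose Z w := h (AX w, theta w).
have mh : measurable_fun setT h.
  have mfine : measurable_fun setT (@fine R) by exact: fine_measurable.
  by apply: measurable_funB; apply: (measurableT_comp mfine);
    exact: posterior_mean_measurable.
have ZO : g_sigma_algebra_preimage Z `<=` calO.
  move=> _ [U mU <-].
  (* Cutting down to [Theta] keeps only parameters at which [h] is known to be constant on orbits;
     the event is unchanged since [theta] takes values there. *)
  exists (h @^-1` U `&` (setT `*` @Theta R n)); last first.
    rewrite setTI; apply/seteqP; split=> [w []//|w Uw].
    by split => //; split => //; exact: theta_Theta.
  split.
  - apply: measurableI; first by rewrite -[X in measurable X]setTI; exact: mh.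
    by apply: measurableX => //; exact: Theta_measurable.
  - by move=> p [].
  - apply/G_saturation_idP => g p g0 [hU [_ p0]].
    split; last by split => //; exact: act_Theta_Theta.
    by rewrite /= /h !(posterior_mean_act _ kappa_poisson).
exists Z => //; split; first split.
(* Invariant events are preimages of measurable sets under [(AX, theta)], so [ZO] also yields
   measurability for the conditioning sigma-algebra. *)
- move=> E /ZO[B [mB _ _] <-]; exists B => //.
  by rewrite setTI.
- by apply: eq_integrable (integrableB measurableT pint nint).
move=> _ [B mB <-]; rewrite setTI.
set E := (fun w => (AX w, theta w)) @^-1` B.
have mE : measurable E.
  by rewrite -[X in measurable X]setTI; apply: measurable_fun_pair.
have sub g : P.-integrable setT g -> P.-integrable E g.
  exact: integrableS.
(* Linearity reduces the defining identity to the positive and negative parts of [f], where [pE] and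
   [nE] apply. *)
transitivity (\int[P]_(w in E) ((f^\+)%R (X w))%:E
  - \int[P]_(w in E) ((f^\-)%R (X w))%:E)%E.
  by rewrite -pE// -nE// -integralB_EFin//; exact: sub.
rewrite -integralB_EFin//; [|exact: sub (integrable_funrpos measurableT Yint)
  |exact: sub (integrable_funrneg measurableT Yint)].
apply: eq_integral => w _.
by rewrite -EFinB -[in RHS](funrposBneg f).
Qed.
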